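(* Let $\mathcal{H}$ be a separable Hilbert space and let $\mathcal{W},\mathcal{V}$ be closed subspaces of $\mathcal{H}$ with $\mathcal{H}=\mathcal{W}\oplus\mathcal{V}^{\perp}$. Let $0\le\epsilon<1$ and $r\ge 0$. Let $\widetilde{\mathcal{G}}=\{\widetilde{g}_k\}_{k=1}^{\infty}$ be a frame for $\mathcal{V}$, let $\mathcal{G}=\{g_k\}_{k=1}^{\infty}\subset\mathcal{V}$ be a sequence such that $\sum_{k=1}^{\infty}|\langle f,g_k-\widetilde{g}_k\rangle|^2\le r\|f\|^2$ for each $f\in\mathcal{V}$, and let $\mathcal{F}=\{f_k\}_{k=1}^{\infty}$ be an oblique dual frame of $\widetilde{\mathcal{G}}$ in $\mathcal{W}$ whose upper frame bound $\beta$ satisfies $\sqrt{\beta r}\le\epsilon$. Then $\mathcal{G}$ is an $\epsilon$-approximate oblique dual frame of $\mathcal{F}$ in $\mathcal{V}$.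
   Context: The direct sum $\mathcal{H}=\mathcal{W}\oplus\mathcal{V}^{\perp}$ (equivalently $\mathcal{H}=\mathcal{V}\oplus\mathcal{W}^{\perp}$) is not assumed orthogonal. $\pi_{\mathcal{W}\mathcal{V}^{\perp}}$ denotes the oblique projection onto $\mathcal{W}$ along $\mathcal{V}^{\perp}$ (identity on $\mathcal{W}$, zero on $\mathcal{V}^{\perp}$); similarly $\pi_{\mathcal{V}\mathcal{W}^{\perp}}$ is the projection onto $\mathcal{V}$ along $\mathcal{W}^{\perp}$. A sequence $\{f_k\}_{k=1}^{\infty}\subset\mathcal{W}$ is a frame for $\mathcal{W}$ (with lower and upper frame bounds $\alpha,\beta$) if $0<\alpha\le\beta<\infty$ and $\alpha\|f\|^2\le\sum_{k}|\langle f,f_k\rangle|^2\le\beta\|f\|^2$ for all $f\in\mathcal{W}$. For such $\mathcal{F}=\{f_k\}$, $T_{\mathcal{F}}:\ell^2\to\mathcal{H}$, $T_{\mathcal{F}}\{c_k\}=\sum_k c_kf_k$ is the synthesis operator, with adjoint $T_{\mathcal{F}}^{*}f=\{\langle f,f_k\rangle\}_k$. Frames $\mathcal{F}$ for $\mathcal{W}$ and $\mathcal{G}$ for $\mathcal{V}$ are $\epsilon$-approximate oblique dual frames ($\epsilon\ge0$) if $\|\pi_{\mathcal{W}\mathcal{V}^{\perp}}-T_{\mathcal{F}}T_{\mathcal{G}}^{*}\|\le\epsilon$ or, equivalently, $\|\pi_{\mathcal{V}\mathcal{W}^{\perp}}-T_{\mathcal{G}}T_{\mathcal{F}}^{*}\|\le\epsilon$;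 one then says $\mathcal{G}$ is an $\epsilon$-approximate oblique dual frame of $\mathcal{F}$ in $\mathcal{V}$ and $\mathcal{F}$ is an $\epsilon$-approximate oblique dual frame of $\mathcal{G}$ in $\mathcal{W}$. For $\epsilon=0$ one says oblique dual frame(s). *)

(* Defs.v *)
From HB Require Import structures.
From mathcomp Require Import all_boot all_order all_algebra complex sesquilinear.
From mathcomp Require Import all_classical all_reals all_analysis.

Set Implicit Arguments.
Unset Strict Implicit.
Unset Printing Implicit Defensive.

Import Order.TTheory GRing.Theory Num.Theory.
Import numFieldNormedType.Exports.

Local Open Scope classical_set_scope.
Local Open Scope ring_scope.

(* A Hilbert space may be real or complex; everything below is uniform in the
   kind of scalars. *)
Inductive scalar_kind := RealScalars | ComplexScalars.

Definition scalar_field (R : realType) (s : scalar_kind) : numFieldType :=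
  match s with RealScalars => R | ComplexScalars => R[i] end.

Definition scalar_conj (R : realType) (s : scalar_kind) :
    scalar_field R s -> scalar_field R s :=
  match s with
  | RealScalars => id
  | ComplexScalars => fun z : R[i] => conjc z
  end.
Arguments scalar_conj {R s}.

Definition scalar_re (R : realType) (s : scalar_kind) : scalar_field R s -> R :=
  match s with
  | RealScalars => id
  | ComplexScalars => fun z : R[i] => complex.Re z
  end.
Arguments scalar_re {R s}.

(* The inner product is linear in its first argument and conjugate-linear in
   its second one; completeness is that of the norm it induces. *)
HB.mixin Record NormedModule_isHilbert (R : realType) (s : scalar_kind) H
    of CompleteNormedModule (scalar_field R s) H := {
  inner : {dot H for @scalar_conj R s} ;
  inner_normE : forall x : H, `|x| ^+ 2 = inner x x
}.

#[short(type="hilbertType")]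
HB.structure Definition Hilbert (R : realType) (s : scalar_kind) :=
  {H of CompleteNormedModule (scalar_field R s) H & NormedModule_isHilbert R s H}.

Definition separable_space (T : topologicalType) :=
  exists2 A : set T, countable A & dense A.

Section HilbertSpace.
Context (R : realType) (s : scalar_kind) (H : hilbertType R s).
Implicit Types (A B V W : set H) (F G : nat -> H).

(* MathComp norms take their values in the field of scalars (in R[i] for
   complex scalars); these are the same norms with values in R. *)
Definition modulus (a : scalar_field R s) : R := scalar_re `|a|.
Definition hnorm (x : H) : R := scalar_re `|x|.

Definition closed_subspace W := closed W /\ GRing.submod_closed [in W].

Definition orthocomp V : set H := [set x | forall v, V v -> inner x v = 0].

(* The algebraic direct sum H = A (+) B, not assumed orthogonal. *)
Definition direct_sum A B :=
  (forall x, exists a b, [/\ A a, B b & x = a + b]) /\ A `&` B = [set 0].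

(* The projection onto A along B: when H = A (+) B, the unique a in A such
   that x - a is in B. *)
Definition oblique_proj A B (x : H) : H := xget 0 [set a | A a /\ B (x - a)].

(* The sum of the squared moduli of the frame coefficients, as an extended
   real: it is +oo when the series diverges. *)
Definition coef_energy F (f : H) : \bar R :=
  (\sum_(0 <= k <oo) (modulus (inner f (F k)) ^+ 2)%:E)%E.

Definition frame_with_bounds W F (alpha beta : R) :=
  [/\ forall k, W (F k), 0 < alpha, alpha <= beta &
      forall f, W f ->
        ((alpha * hnorm f ^+ 2)%:E <= coef_energy F f)%E /\
        (coef_energy F f <= (beta * hnorm f ^+ 2)%:E)%E].

Definition is_frame W F := exists alpha beta, frame_with_bounds W F alpha beta.

Definition upper_frame_bound W F (beta : R) :=
  exists alpha, frame_with_bounds W F alpha beta.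

(* T_F c = \sum_k c_k f_k, the limit of the partial sums in the norm of H; the
   series converges when F is a frame and c is square-summable. *)
Definition synthesis F (c : nat -> scalar_field R s) : H :=
  limn (series (fun k => c k *: F k)).

(* T_F^* f = (<f, f_k>)_k. *)
Definition analysis_op F (f : H) : nat -> scalar_field R s :=
  fun k => inner f (F k).

Definition opnorm (T : H -> H) : \bar R :=
  ereal_sup [set (hnorm (T f))%:E | f in [set f | hnorm f <= 1]].

(* F and G are eps-approximate oblique dual frames, F for W and G for V. *)
Definition approx_oblique_dual (eps : R) W V F G :=
  [/\ is_frame W F, is_frame V G &
      (opnorm (oblique_proj W (orthocomp V) \- (synthesis F \o analysis_op G))%R
         <= eps%:E)%E].

Definition oblique_dual W V F G := approx_oblique_dual 0 W V F G.

End HilbertSpace.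

(* Main.v *)
(** Let pi be the projection onto W along the orthogonal complement of V. Since
    pi = T_F T_G'^*, we have pi - T_F T_G^* = - T_F T_(G - G')^*, and its norm is
    at most sqrt beta * sqrt r once the Bessel bound r of G - G', assumed on V
    only, is extended to the whole space: by duality it bounds the synthesis
    operator of G - G', whose values lie in V, and hence its adjoint. That G is
    a frame for V also follows: for f in V we have <pi f, f> = |f|^2, so
    (1 - eps) |f| <= |T_F T_G^* f| <= sqrt beta * |T_G^* f|. *)

Require Import Defs.
From HB Require Import structures.
From mathcomp Require Import all_boot all_order all_algebra.
From mathcomp Require Import all_classical all_reals all_analysis.
From mathcomp Require Import complex sesquilinear ring lra.

Set Implicit Arguments.
Unset Strict Implicit.
Unset Printing Implicit Defensive.

Import Order.TTheory GRing.Theory Num.Theory.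
Import numFieldNormedType.Exports.

Local Open Scope classical_set_scope.
Local Open Scope ring_scope.

(** * Real parts, conjugation and moduli, uniformly for real and complex scalars *)

Section Scalars.
Context (R : realType) (s : scalar_kind).
Implicit Types (a b z : scalar_field R s) (x y : R).

(** Norms and their epsilons live in the scalar field, frame bounds in [R]; this carries the latter
    over. *)
Definition scalar_of_real : R -> scalar_field R s :=
  match s with
  | RealScalars => id
  | ComplexScalars => fun x : R => (real_complex R x : R[i])
  end.

Lemma scalar_of_realK x : scalar_re (scalar_of_real x) = x.
Proof. by rewrite /scalar_of_real; case: s. Qed.

Lemma scalar_ltR x y : (scalar_of_real x < scalar_of_real y) = (x < y).
Proof. by rewrite /scalar_of_real; case: s => //=; rewrite ltcR. Qed.

Lemma scalar_of_real0 : scalar_of_real 0 = 0.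
Proof. by rewrite /scalar_of_real; case: s. Qed.

Lemma scalar_reK a : 0 <= a -> scalar_of_real (scalar_re a) = a.
Proof.
rewrite /scalar_of_real /scalar_re; case: s a => //= -[u v].
by rewrite lecE /= => /andP[/eqP -> _].
Qed.

Lemma scalar_reD a b : scalar_re (a + b) = scalar_re a + scalar_re b.
Proof. by rewrite /scalar_re; case: s a b => //= -[? ?] [? ?]. Qed.

Lemma scalar_re_sum (I : Type) (r : seq I) (P : pred I) (E : I -> scalar_field R s) :
  scalar_re (\sum_(i <- r | P i) E i) = \sum_(i <- r | P i) scalar_re (E i).
Proof.
apply: (big_morph _ scalar_reD).
by rewrite /scalar_re; case: s.
Qed.

(** A nonnegative element of [R[i]] has zero imaginary part, so the cross term vanishes. *)
Lemma scalar_reM a b : 0 <= a -> 0 <= b ->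
  scalar_re (a * b) = scalar_re a * scalar_re b.
Proof.
rewrite /scalar_re; case: s a b => //= -[? ?] [? ?].
by rewrite !lecE /= => /andP[/eqP -> _] /andP[/eqP -> _]; rewrite mulr0 subr0.
Qed.

Lemma ler_scalar_re a b : a <= b -> scalar_re a <= scalar_re b.
Proof.
rewrite /scalar_re; case: s a b => //= -[? ?] [? ?].
by rewrite lecE /= => /andP[].
Qed.

Lemma scalar_re_le_modulus a : scalar_re a <= modulus a.
Proof.
rewrite /modulus /scalar_re; case: s a => /= [a|a]; first exact: ler_norm.
apply: (le_trans (ler_norm _)).
by have := normc_ge_Re a; rewrite lecE /= => /andP[].
Qed.

Lemma scalar_conj_ge0 a : 0 <= a -> scalar_conj a = a.
Proof.
rewrite /scalar_conj; case: s a => //= -[? ?].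
by rewrite lecE /= => /andP[/eqP -> _]; rewrite oppr0.
Qed.

Lemma mulr_scalar_conj a : a * scalar_conj a = `|a| ^+ 2.
Proof.
rewrite /scalar_conj; case: s a => /= a; last by rewrite sqr_normc.
by rewrite real_normK ?num_real.
Qed.

Lemma norm_scalar_conj a : `|scalar_conj a| = `|a|.
Proof. by rewrite /scalar_conj; case: s a => //= a; rewrite normcJ. Qed.

Lemma modulus_ge0 a : 0 <= modulus a.
Proof.
have -> : 0 = scalar_re (0 : scalar_field R s) by rewrite /scalar_re; case: s.
exact: ler_scalar_re.
Qed.

Lemma modulusM a b : modulus (a * b) = modulus a * modulus b.
Proof. by rewrite /modulus normrM scalar_reM. Qed.

Lemma modulusD a b : modulus (a + b) <= modulus a + modulus b.
Proof. by rewrite /modulus -scalar_reD ler_scalar_re// ler_normD. Qed.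

Lemma modulus_scalar_conj a : modulus (scalar_conj a) = modulus a.
Proof. by rewrite /modulus norm_scalar_conj. Qed.

Lemma modulus_of_real x : 0 <= x -> modulus (scalar_of_real x) = x.
Proof.
move=> x0; rewrite /modulus ger0_norm ?scalar_of_realK//.
by move: x0; rewrite le_eqVlt => /predU1P[<-|x0];
  rewrite ?scalar_of_real0// -scalar_of_real0 ltW// scalar_ltR.
Qed.

End Scalars.

(** * Inner product calculus and the Cauchy-Schwarz inequality *)

Section InnerProduct.
Context (R : realType) (s : scalar_kind) (H : hilbertType R s).
Implicit Types (x y z : H) (a : scalar_field R s).

Lemma innerDl x y z : inner (x + y) z = inner x z + inner y z.
Proof. exact: linearDl. Qed.

Lemma innerBl x y z : inner (x - y) z = inner x z - inner y z.
Proof. exact: linearBl. Qed.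

Lemma innerBr x y z : inner x (y - z) = inner x y - inner x z.
Proof. exact: linearBr. Qed.

Lemma innerZl a x y : inner (a *: x) y = a * inner x y.
Proof. exact: linearZl_LR. Qed.

Lemma innerZr a x y : inner x (a *: y) = scalar_conj a * inner x y.
Proof. exact: linearZr_LR. Qed.

Lemma inner_suml (I : Type) (r : seq I) (P : pred I) (E : I -> H) y :
  inner (\sum_(i <- r | P i) E i) y = \sum_(i <- r | P i) inner (E i) y.
Proof. exact: linear_sumlz. Qed.

Lemma inner_sumr (I : Type) (r : seq I) (P : pred I) (E : I -> H) y :
  inner y (\sum_(i <- r | P i) E i) = \sum_(i <- r | P i) inner y (E i).
Proof. exact: linear_sumr. Qed.

Lemma inner_conj x y : inner x y = scalar_conj (inner y x).
Proof. by rewrite {1}hermitian_subproof expr0 mul1r. Qed.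

Lemma hnorm_ge0 x : 0 <= hnorm x.
Proof.
have := ler_scalar_re (normr_ge0 x).
by rewrite -{1}(scalar_of_real0 R s) scalar_of_realK.
Qed.

Lemma hnormD x y : hnorm (x + y) <= hnorm x + hnorm y.
Proof. by rewrite /hnorm -scalar_reD ler_scalar_re// ler_normD. Qed.

Lemma hnormN x : hnorm (- x) = hnorm x.
Proof. by rewrite /hnorm normrN. Qed.

Lemma hnormZ a x : hnorm (a *: x) = modulus a * hnorm x.
Proof. by rewrite /hnorm normrZ scalar_reM. Qed.

Lemma inner_re_self x : scalar_re (inner x x) = hnorm x ^+ 2.
Proof. by rewrite -inner_normE expr2 scalar_reM. Qed.

Lemma modulus_innerC x y : modulus (inner x y) = modulus (inner y x).
Proof. by rewrite inner_conj modulus_scalar_conj. Qed.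

(* Expand the squared norm of |y|^2 x - <x, y> y, avoiding division. *)
Lemma cauchy_schwarz x y : modulus (inner x y) <= hnorm x * hnorm y.
Proof.
rewrite /modulus /hnorm -scalar_reM//; apply: ler_scalar_re.
have [->|y0] := eqVneq y 0.
  by rewrite linear0r !normr0 mulr0.
have N0 : 0 < inner y y by rewrite -inner_normE exprn_gt0// normr_gt0.
rewrite -(@ler_pXn2r _ 2%N) ?nnegrE ?mulr_ge0//.
have : 0 <= inner (inner y y *: x - inner x y *: y)
                  (inner y y *: x - inner x y *: y).
  by rewrite -inner_normE exprn_ge0.
rewrite innerBl !innerBr !innerZl !innerZr (scalar_conj_ge0 (ltW N0)).
rewrite (inner_conj y x) exprMn !inner_normE -mulr_scalar_conj.
set N := inner y y in N0 *; set z := inner x y; set X := inner x x.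
set z' := scalar_conj z.
have -> : N * (N * X) - N * (z' * z) - (z * (N * z') - z * (z' * N))
   = N * (X * N - z * z') by ring.
by rewrite pmulr_rge0// subr_ge0.
Qed.

End InnerProduct.

(** * Bessel sequences and convergence of the synthesis series *)

Section Bessel.
Context (R : realType) (s : scalar_kind) (H : hilbertType R s).
Implicit Types (f x : H) (F G : nat -> H) (V : set H) (B : R)
  (c : nat -> scalar_field R s).

Lemma energy_ge0 c m n : 0 <= \sum_(m <= k < n) modulus (c k) ^+ 2.
Proof. by apply: sumr_ge0 => k _; rewrite exprn_ge0// modulus_ge0. Qed.

Lemma energy_le_split c m n :
  \sum_(m <= k < n) modulus (c k) ^+ 2 <= \sum_(0 <= k < n) modulus (c k) ^+ 2.
Proof.
have [mn|nm] := leqP m n.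
  by rewrite (big_cat_nat (leq0n m) mn) /= lerDr energy_ge0.
by rewrite big_geq ?energy_ge0// ltnW.
Qed.

(** The terms are nonnegative, so the series is the supremum of its partial sums; all later
    estimates are on finite sums. *)
Lemma coef_energy_leP F f B :
  (coef_energy F f <= B%:E)%E <->
  forall n, \sum_(0 <= k < n) modulus (inner f (F k)) ^+ 2 <= B.
Proof.
have t0 k : (0 <= (modulus (inner f (F k)) ^+ 2)%:E)%E.
  by rewrite lee_fin exprn_ge0// modulus_ge0.
split=> [fB n|fB].
  rewrite -lee_fin -sumEFin; apply: le_trans fB.
  exact: nneseries_lim_ge.
apply: lime_le; first exact: is_cvg_nneseries.
by apply: nearW => n; rewrite sumEFin lee_fin.
Qed.

(** A finite energy is itself an admissible [B], and an infinite one exceeds [X]. *)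
Lemma coef_energy_geP F f X :
  (forall B, (forall n, \sum_(0 <= k < n) modulus (inner f (F k)) ^+ 2 <= B) ->
     X <= B) -> (X%:E <= coef_energy F f)%E.
Proof.
move=> XB.
case E : (coef_energy F f) => [B| |]; last 2 first.
- exact: leey.
- suff : (0 <= coef_energy F f)%E by rewrite E.
  by apply: nneseries_ge0 => k _ _; rewrite lee_fin exprn_ge0// modulus_ge0.
by rewrite lee_fin; apply: XB; apply/coef_energy_leP; rewrite E.
Qed.

(** Relative to [V], to separate bounds known on a subspace from bounds on [setT]. *)
Definition bessel V F B := forall f n, V f ->
  \sum_(0 <= k < n) modulus (inner f (F k)) ^+ 2 <= B * hnorm f ^+ 2.

Lemma comb_mem V F c m n : GRing.submod_closed [in V] -> (forall k, V (F k)) ->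
  V (\sum_(m <= k < n) c k *: F k).
Proof.
move=> [/[!inE] V0 VZD] FV.
elim/big_ind : _ => // [x y Vx Vy|k _].
  by have := VZD 1 x y; rewrite !inE scale1r; apply.
by have := VZD (c k) (F k) 0; rewrite !inE addr0; apply.
Qed.

(* Duality: with x the combination, |x|^2 = \sum c_k <f_k, x>, to which AM-GM
   with weight B applies. *)
Lemma bessel_comb V F B c m n : GRing.submod_closed [in V] ->
  (forall k, V (F k)) -> 0 <= B -> bessel V F B ->
  hnorm (\sum_(m <= k < n) c k *: F k) ^+ 2
    <= B * \sum_(m <= k < n) modulus (c k) ^+ 2.
Proof.
move=> Vsub FV B0 FB; set x := \sum_(m <= k < n) _.
(* This lets a bound known only on [V] be tested at [x] itself. *)
have Vx : V x by exact: comb_mem.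
pose b k := modulus (inner x (F k)).
have bB : \sum_(m <= k < n) b k ^+ 2 <= B * hnorm x ^+ 2.
  by apply: le_trans (FB x n Vx); apply: energy_le_split.
have Qab : hnorm x ^+ 2 <= \sum_(m <= k < n) modulus (c k) * b k.
  rewrite -inner_re_self {1}/x inner_suml scalar_re_sum; apply: ler_sum => k _.
  by rewrite innerZl (le_trans (scalar_re_le_modulus _))// modulusM modulus_innerC.
have AMGM : 2 * B * hnorm x ^+ 2 <= B ^+ 2 * \sum_(m <= k < n) modulus (c k) ^+ 2
    + \sum_(m <= k < n) b k ^+ 2.
  apply: (@le_trans _ _ (2 * B * \sum_(m <= k < n) modulus (c k) * b k)).
    by rewrite ler_wpM2l// mulr_ge0.
  rewrite !big_distrr -big_split /=; apply: ler_sum => k _.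
  by have := sqr_ge0 (B * modulus (c k) - b k); nra.
(* For [B > 0], [AMGM] and [bB] combine and [B] cancels. For [B = 0], [bB] forces every [b k] to
   vanish, and [Qab] gives [x] norm zero. *)
move: B0; rewrite le_eqVlt => /predU1P[B0|B0]; last first.
  by rewrite -(ler_pM2l B0); lra.
rewrite -B0 mul0r; apply: (le_trans Qab); rewrite big1_seq// => k /andP[_ kmn].
suff -> : b k = 0 by rewrite mulr0.
apply/eqP; rewrite -sqrf_eq0 eq_le sqr_ge0 andbT.
rewrite -[leRHS](mul0r (hnorm x ^+ 2)) B0; apply: le_trans bB.
by rewrite (big_rem k)//= lerDl sumr_ge0// => i _; rewrite sqr_ge0.
Qed.

(** An operator and its adjoint have the same norm: [P] is the inner product of [f] with [x], which
    [bessel_comb] controls, so [P ^+ 2 <= hnorm f ^+ 2 * (B * P)], and a nonzero [P] cancels. *)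
Lemma bessel_extend V F B : GRing.submod_closed [in V] ->
  (forall k, V (F k)) -> 0 <= B -> bessel V F B -> bessel setT F B.
Proof.
move=> Vsub FV B0 FB f n _; set P := \sum_(0 <= k < n) _.
have P0 : 0 <= P by exact: energy_ge0.
set x := \sum_(0 <= k < n) inner f (F k) *: F k.
have xB : hnorm x ^+ 2 <= B * P by exact: (bessel_comb (V := V)).
have Pfx : P <= hnorm f * hnorm x.
  apply: le_trans (cauchy_schwarz f x); apply: le_trans (scalar_re_le_modulus _).
  rewrite inner_sumr scalar_re_sum; apply: ler_sum => k _.
  by rewrite innerZr mulrC mulr_scalar_conj [in leRHS]expr2 scalar_reM.
have P2 : P ^+ 2 <= hnorm f ^+ 2 * (B * P).
  apply: (@le_trans _ _ ((hnorm f * hnorm x) ^+ 2)).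
    by rewrite ler_pXn2r// nnegrE ?mulr_ge0 ?hnorm_ge0.
  by rewrite exprMn ler_wpM2l// sqr_ge0.
move: P0; rewrite le_eqVlt => /predU1P[<-|P0].
  by rewrite mulr_ge0// sqr_ge0.
by rewrite -(ler_pM2r P0) -expr2 (le_trans P2)// mulrCA mulrA.
Qed.

Lemma hnorm_cvg (u : nat -> H) x (e : R) : u @ \oo --> x -> 0 < e ->
  \forall n \near \oo, hnorm (x - u n) < e.
Proof.
move=> ux e0.
have e0' : 0 < scalar_of_real s e by rewrite -(scalar_of_real0 R s) scalar_ltR.
move/cvgrPdist_lt : ux => /(_ _ e0'); apply: filterS => n.
by rewrite -(scalar_reK (normr_ge0 _)) scalar_ltR.
Qed.

(** Cauchy criterion: [bessel_comb] dominates each block by a block of the convergent series of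
    squared moduli. *)
Lemma bessel_cvg_synthesis F B c S : 0 <= B -> bessel setT F B ->
  (forall n, \sum_(0 <= k < n) modulus (c k) ^+ 2 <= S) ->
  cvgn (series (fun k => c k *: F k)).
Proof.
move=> B0 FB cS; apply: cauchy_cvg; apply/cauchy_seriesP => e e0.
have eE : e = scalar_of_real s (scalar_re e) by rewrite scalar_reK// ltW.
set d := scalar_re e in eE.
have d0 : 0 < d by rewrite -(scalar_ltR s) scalar_of_real0 -eE.
have cvc : cvgn (series (fun k => modulus (c k) ^+ 2)).
  apply: nondecreasing_is_cvgn.
    by apply/nondecreasing_series => k _ _; rewrite sqr_ge0.
  by exists S => _ [n _ <-]; exact: cS.
(* Dividing by [B + 1] rather than [B] covers [B = 0]. *)
have B1 : 0 < B + 1 by rewrite ltr_wpDl.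
have dB0 : 0 < d ^+ 2 / (B + 1) by rewrite divr_gt0 ?exprn_gt0.
have cauchyc : cauchy (series (fun k => modulus (c k) ^+ 2) @ \oo).
  exact: cvg_cauchy.
have := (cauchy_seriesP (V := R^o) _).1 cauchyc _ dB0.
apply: filterS => -[m n] /= mn.
rewrite -(scalar_reK (normr_ge0 _)) eE scalar_ltR -[scalar_re _]/(hnorm _).
rewrite -(@ltr_pXn2r _ 2%N) ?nnegrE ?hnorm_ge0 ?(ltW d0)//.
have VT : GRing.submod_closed [in [set: H]].
  by split=> [|a x y _ _]; rewrite inE.
apply: (le_lt_trans (@bessel_comb setT F B c m n VT _ B0 FB)) => //.
move: mn; rewrite ger0_norm ?energy_ge0// ltr_pdivlMr//.
apply: le_lt_trans; rewrite mulrC ler_wpM2l ?energy_ge0//.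
by rewrite lerDl.
Qed.

(** Each partial sum obeys the bound by [bessel_comb], and the limit inherits it up to an arbitrary
    [e > 0]. *)
Lemma hnorm_synthesis F B c S : 0 <= B -> bessel setT F B ->
  (forall n, \sum_(0 <= k < n) modulus (c k) ^+ 2 <= S) ->
  hnorm (synthesis F c) ^+ 2 <= B * S.
Proof.
move=> B0 FB cS.
have S0 : 0 <= S by have := cS 0%N; rewrite big_geq.
have BS0 : 0 <= B * S by exact: mulr_ge0.
have VT : GRing.submod_closed [in [set: H]].
  by split=> [|a x y _ _]; rewrite inE.
rewrite -[leRHS]sqr_sqrtr// ler_pXn2r ?nnegrE ?hnorm_ge0 ?sqrtr_ge0//.
apply/ler_addgt0Pr => e e0.
have cv := bessel_cvg_synthesis B0 FB cS.
have [N _ /(_ N (leqnn N))] := hnorm_cvg cv e0.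
rewrite /= -/(synthesis F c) => Ne.
rewrite -[synthesis F c](subrK (series (fun k => c k *: F k) N)).
apply: (le_trans (hnormD _ _)); rewrite addrC lerD//; last exact: ltW.
rewrite -[leLHS]ger0_norm ?hnorm_ge0// -sqrtr_sqr ler_wsqrtr//.
apply: (le_trans (@bessel_comb setT F B c 0 N VT _ B0 FB)) => //.
by rewrite ler_wpM2l.
Qed.

(** Limits add once both series converge, which the energy bounds [S] and [T] ensure. *)
Lemma synthesisD F B c d S T : 0 <= B -> bessel setT F B ->
  (forall n, \sum_(0 <= k < n) modulus (c k) ^+ 2 <= S) ->
  (forall n, \sum_(0 <= k < n) modulus (d k) ^+ 2 <= T) ->
  synthesis F (fun k => c k + d k) = synthesis F c + synthesis F d.
Proof.
move=> B0 FB cS dT.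
have cv := bessel_cvg_synthesis B0 FB cS.
have dv := bessel_cvg_synthesis B0 FB dT.
rewrite /synthesis -limD//; congr (limn _); apply/funext => n.
rewrite fctE /series /= -big_split /=.
by apply: eq_bigr => k _; rewrite scalerDl.
Qed.

End Bessel.

(** * Oblique projections and the frame property from approximate duality *)

Section ApproximateDuality.
Context (R : realType) (s : scalar_kind) (H : hilbertType R s).
Implicit Types (f : H) (F G : nat -> H) (V W : set H).

Lemma frame_bessel W F alpha beta : GRing.submod_closed [in W] ->
  frame_with_bounds W F alpha beta -> 0 < beta /\ bessel setT F beta.
Proof.
move=> Wsub [FW a0 ab Fab].
have b0 : 0 < beta by exact: lt_le_trans ab.
split=> //; apply: (bessel_extend Wsub FW (ltW b0)) => f n Wf.
by move: n; apply/coef_energy_leP; have [] := Fab f Wf.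
Qed.

Lemma opnorm_leP (T : H -> H) (e : R) :
  (opnorm T <= e%:E)%E <-> forall f, hnorm f <= 1 -> hnorm (T f) <= e.
Proof.
split=> [Te f f1|Te].
  by rewrite -lee_fin; apply: le_trans Te; apply: ereal_sup_ubound; exists f.
by apply: ge_ereal_sup => _ [f f1 <-]; rewrite lee_fin; exact: Te.
Qed.

(** A decomposition of [f] makes the set under [xget] nonempty, so the default 0 is not taken. *)
Lemma oblique_projP A B (f : H) : direct_sum A B ->
  A (oblique_proj A B f) /\ B (f - oblique_proj A B f).
Proof.
move=> [AB _]; have [a [b [Aa Bb ->]]] := AB f.
apply: (@xgetPex _ 0 [set a' | A a' /\ B (a + b - a')]).
by exists a; split=> //; rewrite addrAC subrr add0r.
Qed.

(** From [(p + q) ^+ 2 <= 2 * (p ^+ 2 + q ^+ 2)]; the constant need not be sharp, since it only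
    serves to give [G] some upper frame bound. *)
Lemma besselD F G B C : bessel setT F B -> bessel setT G C ->
  bessel setT (fun k => F k + G k) (2 * (B + C)).
Proof.
move=> FB GC f n _.
have := FB f n I; have := GC f n I.
set SG := \sum_(0 <= k < n) _ => SGC; set SF := \sum_(0 <= k < n) _ => SFB.
apply: (@le_trans _ _ (2 * (SF + SG))); last by lra.
rewrite -big_split big_distrr /=; apply: ler_sum => k _.
rewrite [inner f (_ + _)]linearD.
have := modulusD (inner f (F k)) (inner f (G k)).
have := modulus_ge0 (inner f (F k) + inner f (G k)).
set u := modulus (_ + _); set p := modulus _; set q := modulus _ => u0 upq.
apply: (@le_trans _ _ ((p + q) ^+ 2)).
  by rewrite ler_pXn2r// nnegrE// (le_trans u0).
by have := sqr_ge0 (p - q); nra.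
Qed.

(* For f in V, |f|^2 = <pi f, f> since f - pi f is orthogonal to V; so if pi is
   within eps < 1 of T_F T_G^*, then (1 - eps) |f| <= |T_F T_G^* f|. *)
Lemma near_projection_lower_bound W V F G (eps : R) f :
  direct_sum W (orthocomp V) ->
  hnorm (oblique_proj W (orthocomp V) f - synthesis F (analysis_op G f)) <= eps ->
  V f -> hnorm f = 1 -> 1 - eps <= hnorm (synthesis F (analysis_op G f)).
Proof.
move=> Hsum + Vf f1; have [_] := oblique_projP f Hsum.
set p := oblique_proj _ _ _; set t := synthesis _ _ => ort fe.
have pf : scalar_re (inner p f) = 1.
  have := ort f Vf; rewrite innerBl => /eqP; rewrite subr_eq0 => /eqP <-.
  by rewrite inner_re_self f1 expr1n.
rewrite lerBlDr -pf -(subrK t p) innerDl scalar_reD addrC lerD//.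
  apply: (le_trans (scalar_re_le_modulus _)).
  by rewrite (le_trans (cauchy_schwarz _ _))// f1 mulr1.
apply: (le_trans (scalar_re_le_modulus _)).
by rewrite (le_trans (cauchy_schwarz _ _))// f1 mulr1.
Qed.

Lemma near_projection_is_frame W V F G (eps beta C : R) :
  GRing.submod_closed [in V] -> direct_sum W (orthocomp V) -> eps < 1 ->
  0 < beta -> bessel setT F beta -> (forall k, V (G k)) -> bessel setT G C ->
  (forall f, hnorm f <= 1 ->
     hnorm (oblique_proj W (orthocomp V) f - synthesis F (analysis_op G f))
       <= eps) ->
  is_frame V G.
Proof.
move=> Vsub Hsum e1 b0 FB GV GC Ge.
(* The lower bound comes from squaring [1 - eps <= |T_F T_G^* u| <= sqrt beta * |T_G^* u|] at unit
   [u]; the maximum keeps the two bounds ordered. *)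
exists ((1 - eps) ^+ 2 / beta), (Num.max ((1 - eps) ^+ 2 / beta) C).
split=> //.
- by rewrite divr_gt0// exprn_gt0// subr_gt0.
- by rewrite le_max lexx.
move=> f Vf; split; last first.
  apply/coef_energy_leP => n; apply: (le_trans (GC f n I)).
  by rewrite ler_wpM2r ?sqr_ge0// le_max lexx orbT.
apply: coef_energy_geP => X fX.
have [f0|f0] := eqVneq (hnorm f) 0.
  by rewrite f0 expr0n mulr0; have := fX 0%N; rewrite big_geq.
have fp : 0 < hnorm f by rewrite lt_def f0 hnorm_ge0.
have fV0 : 0 <= (hnorm f)^-1 by rewrite invr_ge0 ltW.
(* [Ge] covers the unit ball only, so [f] is normalised; its energy scales by the inverse square of
   its norm. *)
pose u := scalar_of_real s (hnorm f)^-1 *: f.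
have u1 : hnorm u = 1 by rewrite hnormZ modulus_of_real// mulVf.
have Vu : V u.
  case: Vsub => V0 /(_ (scalar_of_real s (hnorm f)^-1) f 0).
  by rewrite addr0 !inE in V0 *; apply.
have uX n : \sum_(0 <= k < n) modulus (inner u (G k)) ^+ 2 <= X / hnorm f ^+ 2.
  rewrite ler_pdivlMr ?exprn_gt0// mulr_suml; apply: le_trans (fX n).
  apply: ler_sum => k _; rewrite innerZl modulusM modulus_of_real// -exprMn.
  by rewrite mulrAC mulVf// mul1r.
have := near_projection_lower_bound Hsum (Ge u _) Vu u1; rewrite u1 => /(_ (lexx _)).
rewrite -(@ler_pXn2r _ 2%N) ?nnegrE ?hnorm_ge0 ?subr_ge0 ?(ltW e1)// => lo.
have := le_trans lo (hnorm_synthesis (ltW b0) FB uX).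
rewrite mulrA ler_pdivlMr ?exprn_gt0// => le.
by rewrite mulrAC ler_pdivrMr// (mulrC X).
Qed.

End ApproximateDuality.

(** * Perturbing one member of an oblique dual pair *)

Theorem proposition6p1 (R : realType) (s : scalar_kind) (H : hilbertType R s)
    (Hsep : separable_space H) (W V : set H)
    (HW : closed_subspace W) (HV : closed_subspace V)
    (Hsum : direct_sum W (orthocomp V))
    (eps r : R) (eps_ge0 : 0 <= eps) (eps_lt1 : eps < 1) (r_ge0 : 0 <= r)
    (G' : nat -> H) (HG' : is_frame V G')
    (G : nat -> H) (HG : forall k, V (G k))
    (HGr : forall f, V f ->
       (coef_energy (fun k => (G k - G' k)%R) f <= (r * hnorm f ^+ 2)%:E)%E)
    (F : nat -> H) (HF : oblique_dual W V F G')
    (beta : R) (Hbeta : upper_frame_bound W F beta)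
    (Hbr : Num.sqrt (beta * r) <= eps) :
  approx_oblique_dual eps W V F G.
Proof.
have [_ Wsub] := HW; have [_ Vsub] := HV.
have [alpha Fab] := Hbeta; have [b0 FB] := frame_bessel Wsub Fab.
have [a' [b' G'ab]] := HG'; have [b'0 G'B] := frame_bessel Vsub G'ab.
have G'V : forall k, V (G' k) by case: G'ab.
have [frF _ dualFG'] := HF.
have DV k : V (G k - G' k).
  case: Vsub => _ /(_ (-1) (G' k) (G k)).
  by rewrite !inE scaleN1r addrC; apply.
have DB : bessel setT (fun k => G k - G' k) r.
  apply: (bessel_extend Vsub DV r_ge0) => f n Vf.
  by move: n; apply/coef_energy_leP; exact: HGr.
have near f : hnorm f <= 1 ->
    hnorm (oblique_proj W (orthocomp V) f - synthesis F (analysis_op G f)) <= eps.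
  move=> f1.
  (* Splitting [G] as [G'] plus [G - G'] leaves the error of the exact dual [G'] and a perturbation
     term [t]. *)
  have -> : analysis_op G f =
      (fun k => analysis_op G' f k + analysis_op (fun k => G k - G' k) f k).
    by apply/funext => k; rewrite /analysis_op innerBr addrC subrK.
  rewrite (synthesisD (ltW b0) FB (fun n => G'B f n I) (fun n => DB f n I)).
  set t := synthesis F (analysis_op (fun k => G k - G' k) f).
  rewrite opprD addrA; apply: (le_trans (hnormD _ _)).
  have /opnorm_leP /(_ f f1) /= dual0 := dualFG'.
  (* Exact duality contributes 0, so the whole of [eps] is available for [t]. *)
  rewrite -[leRHS]add0r lerD// hnormN; apply: le_trans Hbr.
  rewrite -[leLHS]ger0_norm ?hnorm_ge0// -sqrtr_sqr ler_wsqrtr//.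
  apply: (le_trans (hnorm_synthesis (ltW b0) FB (fun n => DB f n I))).
  rewrite ler_wpM2l ?(ltW b0)// ler_piMr//.
  by rewrite expr_le1// hnorm_ge0.
split=> //; last by apply/opnorm_leP => f; exact: near.
(* This [C] is the constant of [besselD] for [G - G'] and [G']. *)
apply: (near_projection_is_frame (C := 2 * (r + b')) Vsub Hsum eps_lt1 b0 FB HG)
  => //.
have := besselD DB G'B; congr (bessel _ _ _).
by apply/funext => k; rewrite subrK.
Qed.
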